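(* Let $\mathrm{L}$ be a Markov operator with invariant and reversible probability measure $\mu$, carré du champ $\Gamma$, and pure point spectrum $S=\{0=\lambda_0<\lambda_1<\lambda_2<\cdots\}$ (the spectrum of $-\mathrm{L}$). Let $k\ge 1$ and let $F$ be a $k$-chaos eigenfunction with eigenvalue $\lambda_k$, that is, $-\mathrm{L}F=\lambda_kF$ and $Q_{k+1}(\Gamma)(F)=0$ $\mu$-almost everywhere. Write $\Gamma(F)=\Gamma(F,F)$. If $$(-1)^k\,T_{k+1}\!\left(-\frac{\lambda_n}{2}\right)\le 0\qquad\text{for every } n\in\mathbb N,$$ then $$\int_E\Gamma(F)^2\,d\mu\le\lambda_k\int_E F^2\,\Gamma(F)\,d\mu .$$ In particular, if moreover $\int_E F^2\,d\mu=1$, then $\int_E\Gamma(F)\,d\mu=\lambda_k$ and $$\operatorname{Var}_\mu(\Gamma(F))\le\lambda_k\left(\int_E F^2\,\Gamma(F)\,d\mu-\lambda_k\right).$$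
   Context: Setting. $(E,\mathcal F,\mu)$ is a probability space; $\mathrm{L}$ is a Markov operator (the generator of a symmetric Markov semigroup, not necessarily a diffusion) acting on a suitable algebra $\mathcal A$ of real functions on $E$, with $\mathrm{L}1=0$, and $\mu$ is invariant and reversible: $\int_E f\,\mathrm{L}g\,d\mu=\int_E g\,\mathrm{L}f\,d\mu$. The carré du champ is $\Gamma(f,g)=\frac12[\mathrm{L}(fg)-f\mathrm{L}g-g\mathrm{L}f]$, $\Gamma(f)=\Gamma(f,f)\ge 0$; thus $\int_E f(-\mathrm{L}g)\,d\mu=\int_E\Gamma(f,g)\,d\mu$. $\mathrm{L}$ has pure point spectrum: $-\mathrm{L}$ has a countable sequence of eigenvalues $S=\{0=\lambda_0<\lambda_1<\lambda_2<\cdots\}$ and $L^2(\mu)$ is the orthogonal direct sum of the corresponding eigenspaces; $\mathrm{L}$ is ergodic ($\Gamma(f)=0$ implies $f$ constant $\mu$-a.e.). $\operatorname{Var}_\mu(f)=\int_E f^2d\mu-(\int_E f\,d\mu)^2$. Standing assumption: eigenfunctions are assumed to satisfy all domain and integrability conditions needed for the quantities and identities involved (integration by parts/symmetry of $\mathrm{L}$, and the iterated gradients) to make sense and be valid. Iterated gradients: $\Gamma_0(f,g)=fg$, $\Gamma_1=\Gamma$, and for $m\ge2$, $\Gamma_m(f,g)=\frac12[\mathrm{L}\Gamma_{m-1}(f,g)-\Gamma_{m-1}(f,\mathrm{L}g)-\Gamma_{m-1}(g,\mathrm{L}f)]$; $\Gamma_m(f)=\Gamma_m(f,f)$. Polynomials: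 for $k\ge1$, $Q_k(X)=\prod_{i=0}^{k-1}(X-\lambda_i)=\sum_{i=1}^k\frac1{i!}Q_k^{(i)}(0)X^i$, and $Q_k(\Gamma)=\sum_{i=1}^k\frac1{i!}Q_k^{(i)}(0)\,\Gamma_i$ (bilinear form), with $Q_k(\Gamma)(F)$ meaning $Q_k(\Gamma)(F,F)$. For $k\ge1$, $$R_{k+1}(X)=\frac1{X^2}\big[Q_{k+1}(X)-Q_{k+1}^{(1)}(0)X\big]=\sum_{i=2}^{k+1}\frac1{i!}Q_{k+1}^{(i)}(0)X^{i-2},\qquad T_{k+1}(X)=R_{k+1}(X+\lambda_k)-R_{k+1}(\lambda_k).$$ *)

(* Defs.v *)
From HB Require Import structures.
From mathcomp Require Import all_boot all_order all_algebra.
From mathcomp Require Import all_classical all_reals all_analysis.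

Set Implicit Arguments.
Unset Strict Implicit.
Unset Printing Implicit Defensive.

Import Order.TTheory GRing.Theory Num.Theory.
Import numFieldNormedType.Exports.

Local Open Scope classical_set_scope.
Local Open Scope ring_scope.

(* Elements of L^2(mu) are represented by square-integrable measurable
   functions; accordingly identities between functions are mu-a.e. ones, and
   operators act on functions, compatibly with a.e. equality (sg_ae). *)

Section markov_operator.
Context {d : measure_display} {E : measurableType d} {R : realType}.
Variable mu : probability E R.

Definition L2 : set (E -> R) := [set f | f \in Lfun mu 2%:E].

Definition L2norm (f : E -> R) : \bar R := ('N[mu]_2%:E [EFin \o f])%E.

(* Only the values P t for t >= 0 on L^2(mu) matter. *)
Record symmetric_markov_semigroup (P : R -> (E -> R) -> (E -> R)) : Prop := {
  sg_L2 : forall (t : R) f, 0 <= t -> L2 f -> L2 (P t f) ;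
  sg_ae : forall (t : R) f g, 0 <= t -> L2 f -> L2 g ->
    f = g %[ae mu] -> P t f = P t g %[ae mu] ;
  sg_linear : forall (t : R) a f g, 0 <= t -> L2 f -> L2 g ->
    P t (a *: f + g) = a *: P t f + P t g %[ae mu] ;
  sg_id : forall f, L2 f -> P 0 f = f %[ae mu] ;
  sg_add : forall (s t : R) f, 0 <= s -> 0 <= t -> L2 f ->
    P (s + t) f = P s (P t f) %[ae mu] ;
  sg_continuous : forall f, L2 f -> L2norm (P t f - f) @[t --> 0^'+] --> 0%E ;
  sg_positive : forall (t : R) f, 0 <= t -> L2 f ->
    {ae mu, forall x, 0 <= f x} -> {ae mu, forall x, 0 <= P t f x} ;
  sg_mass : forall t : R, 0 <= t -> P t (cst 1) = cst 1 %[ae mu] ;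
  sg_symmetric : forall (t : R) f g, 0 <= t -> L2 f -> L2 g ->
    \int[mu]_x (f x * P t g x) = \int[mu]_x (g x * P t f x) }.

Definition generator_limit (P : R -> (E -> R) -> (E -> R)) (f g : E -> R) :=
  L2norm (t^-1 *: (P t f - f) - g) @[t --> 0^'+] --> 0%E.

Definition generator_domain (P : R -> (E -> R) -> (E -> R)) : set (E -> R) :=
  [set f | L2 f /\ exists2 g, L2 g & generator_limit P f g].

Section gamma.
Variable L : (E -> R) -> (E -> R).

Definition Gamma (f g : E -> R) : E -> R :=
  2^-1 *: (L (f * g) - f * L g - g * L f).

Fixpoint Gamma_iter (m : nat) (f g : E -> R) : E -> R :=
  match m with
  | 0 => f * g
  | 1 => Gamma f g
  | m'.+1 => 2^-1 *: (L (Gamma_iter m' f g) - Gamma_iter m' f (L g)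
                      - Gamma_iter m' g (L f))
  end.

End gamma.

(* L, meaningful on generator_domain P, is the L^2(mu)-generator of P, and A is
   the algebra of functions on which the carré du champ lives. *)
Record markov_operator (P : R -> (E -> R) -> (E -> R))
    (L : (E -> R) -> (E -> R)) (A : set (E -> R)) : Prop := {
  mo_semigroup : symmetric_markov_semigroup P ;
  mo_generator : forall f, generator_domain P f ->
    L2 (L f) /\ generator_limit P f (L f) ;
  mo_dom : A `<=` generator_domain P ;
  mo_alg1 : A (cst 1) ;
  mo_algD : forall a f g, A f -> A g -> A (a *: f + g) ;
  mo_algM : forall f g, A f -> A g -> A (f * g) ;
  mo_one : L (cst 1) = cst 0 %[ae mu] ;
  mo_invariant : forall f, generator_domain P f -> \int[mu]_x L f x = 0 ;
  mo_reversible : forall f g, generator_domain P f -> generator_domain P g ->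
    \int[mu]_x (f x * L g x) = \int[mu]_x (g x * L f x) ;
  mo_Gamma_ge0 : forall f, A f -> {ae mu, forall x, 0 <= Gamma L f f x} ;
  mo_ergodic : forall f, A f -> Gamma L f f = cst 0 %[ae mu] ->
    exists c : R, f = cst c %[ae mu] }.

Definition eigenspace_of (P : R -> (E -> R) -> (E -> R))
    (L : (E -> R) -> (E -> R)) (a : R) : set (E -> R) :=
  [set f | generator_domain P f /\ - L f = a *: f %[ae mu]].

Definition eigenvalue_of (P : R -> (E -> R) -> (E -> R))
    (L : (E -> R) -> (E -> R)) (a : R) : Prop :=
  exists2 f, eigenspace_of P L a f & ~ (f = cst 0 %[ae mu]).

Record pure_point_spectrum (P : R -> (E -> R) -> (E -> R))
    (L : (E -> R) -> (E -> R)) (lambda : nat -> R) : Prop := {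
  pps_0 : lambda 0%N = 0 ;
  pps_increasing : {homo lambda : m n / (m < n)%N >-> m < n} ;
  pps_eigenvalues : forall a, eigenvalue_of P L a <-> exists n, a = lambda n ;
  pps_orthogonal : forall (m n : nat) f g, m != n ->
    eigenspace_of P L (lambda m) f -> eigenspace_of P L (lambda n) g ->
    \int[mu]_x (f x * g x) = 0 ;
  pps_complete : forall f, L2 f -> exists2 h : nat -> (E -> R),
    (forall n, eigenspace_of P L (lambda n) (h n)) &
    L2norm (f - \sum_(n < N) h n) @[N --> \oo] --> 0%E }.

End markov_operator.

Section polynomials.
Context {R : realType}.
Variable lambda : nat -> R.

Definition Qpoly (k : nat) : {poly R} := \prod_(i < k) ('X - (lambda i)%:P).

Definition Qcoef (k i : nat) : R := (i`!%:R)^-1 * (Qpoly k)^`(i).[0].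

Definition Rpoly (m : nat) : {poly R} :=
  \sum_(2 <= i < m.+1) Qcoef m i *: 'X^(i - 2).

(* T_m, shifted by lambda_(m-1): Tpoly k.+1 is R_(k+1)(X + lambda_k)
   - R_(k+1)(lambda_k). *)
Definition Tpoly (m : nat) : {poly R} :=
  (Rpoly m) \Po ('X + (lambda m.-1)%:P) - ((Rpoly m).[lambda m.-1])%:P.

End polynomials.

Section chaos.
Context {d : measure_display} {E : measurableType d} {R : realType}.
Variables (mu : probability E R) (P : R -> (E -> R) -> (E -> R)).
Variables (L : (E -> R) -> (E -> R)) (lambda : nat -> R).

Definition QGamma (k : nat) (f g : E -> R) : E -> R :=
  \sum_(1 <= i < k.+1) Qcoef lambda k i *: Gamma_iter L i f g.

(* chaos_domain is the domain and integrability requirement under which the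
   iterated gradients entering Q_(k+1)(Gamma)(F) make sense: L is applied to
   Gamma_0(F) = F^2, Gamma_1(F), ..., Gamma_k(F). *)
Record chaos_eigenfunction (k : nat) (F : E -> R) : Prop := {
  chaos_eigen : eigenspace_of mu P L (lambda k) F ;
  chaos_domain : forall m, (m <= k)%N ->
    generator_domain mu P (Gamma_iter L m F F) ;
  chaos_QGamma : QGamma k.+1 F F = cst 0 %[ae mu] }.

End chaos.

(* Main.v *)
Require Import Defs.
From HB Require Import structures.
From mathcomp Require Import all_boot all_order all_algebra.
From mathcomp Require Import all_classical all_reals all_analysis.
From mathcomp Require Import measurable_realfun qpoly.
From mathcomp Require Import ring lra.
Import Order.TTheory GRing.Theory Num.Theory.
Import numFieldNormedType.Exports.
Local Open Scope classical_set_scope.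
Local Open Scope ring_scope.

(** Put M = L/2 + lambda_k. Since F is an eigenfunction, the definition of the
    iterated gradients collapses on the diagonal to Gamma_(m+1)(F) =
    M Gamma_m(F), so that Gamma_m(F) = M^m(F^2) (lemma [Gamma_iter_rec]).
    As Q_(k+1) has no constant term (lambda_0 = 0), the chaos condition then
    reads Q_(k+1)(M)(F^2) = 0: on F^2, the operator M is annihilated by a
    polynomial with the simple roots lambda_0 < ... < lambda_k.

    Hence F^2 splits into finitely many eigenfunctions: with l_i the Lagrange
    polynomials at these roots, u_i = l_i(M)(F^2) satisfies
    M u_i = lambda_i u_i, because (X - lambda_i) l_i is a multiple of Q_(k+1),
    and X^m = sum_i lambda_i^m l_i gives Gamma_m(F) = sum_i lambda_i^m u_i for
    m <= k (lemma [chaos_decomposition]). In particular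
      F^2 = sum_i u_i     and     Gamma(F) = sum_i lambda_i u_i.

    The u_i are eigenfunctions of -L with distinct eigenvalues
    2 (lambda_k - lambda_i), so reversibility makes them orthogonal
    (lemma [eigenspace_orthogonal]), and the inequality
      int Gamma(F)^2 = sum_i lambda_i^2 |u_i|^2
        <= lambda_k sum_i lambda_i |u_i|^2 = lambda_k int F^2 Gamma(F)
    holds term by term, as 0 <= lambda_i <= lambda_k. The variance bound follows
    by subtracting the square of the mean of Gamma(F), which is
    lambda_k int F^2 by invariance of mu.

    Linearity of the semigroup and the eigenvalue equation hold only almost
    everywhere, while L acts on functions. It is therefore first shown, from the uniqueness of limits in
    L^2, that L is linear up to almost everywhere equality on its domain and
    that the domain is stable under almost everywhere modification
    (lemma [generator_lin]). *)

(** * Square-integrable functions up to almost everywhere equality *)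

Section L2_space.
Context {d : measure_display} {E : measurableType d} {R : realType}.
Variable mu : probability E R.
Implicit Types (f g h u v : E -> R) (a : R).

Lemma L2_measurable f : L2 mu f -> measurable_fun setT f.
Proof. by rewrite /L2/= inE => /andP[]; rewrite inE. Qed.

Lemma L2_lin a f g : L2 mu f -> L2 mu g -> L2 mu (a *: f + g).
Proof.
move=> f2 g2.
by have [_ /(_ a f g f2 g2)] := Lfun_submod_closed mu (lee1n 2 : (1 <= 2%:E)%E).
Qed.

Lemma L2_scale a f : L2 mu f -> L2 mu (a *: f).
Proof.
by move=> f2; rewrite -(subrK f (a *: f)) -{2}(scale1r f) -scalerBl; exact: L2_lin.
Qed.

Lemma L2_sub f g : L2 mu f -> L2 mu g -> L2 mu (f - g).
Proof. by move=> f2 g2; rewrite addrC -scaleN1r; exact: L2_lin. Qed.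

Lemma L2_sum (I : finType) (c : I -> R) (f : I -> E -> R) :
  (forall i, L2 mu (f i)) -> L2 mu (\sum_i c i *: f i).
Proof.
move=> f2; elim: (index_enum I) => [|i r IHr].
  rewrite big_nil.
  exact: (Lfun_submod_closed mu (lee1n 2 : (1 <= 2%:E)%E)).1.
by rewrite big_cons; exact: L2_lin.
Qed.

Lemma L2norm_ae f g : measurable_fun setT f -> measurable_fun setT g ->
  f = g %[ae mu] -> L2norm mu f = L2norm mu g.
Proof.
move=> mf mg fg; rewrite /L2norm unlock /=; congr poweR.
have mpow h : measurable_fun setT h ->
    measurable_fun setT (fun x => (`|h x| `^ 2)%:E).
  move=> mh; apply/measurable_EFinP.
  by apply: (measurableT_comp (measurable_powR _)); exact: measurableT_comp.
apply: ae_eq_integral; [by []|exact: mpow|exact: mpow|].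
by apply: filterS fg => x /[apply] ->.
Qed.

Lemma L2_ae f g : measurable_fun setT f -> L2 mu g -> f = g %[ae mu] -> L2 mu f.
Proof.
move=> mf g2 fg; have mg := L2_measurable g g2.
rewrite /L2/= inE; apply/andP; split; rewrite inE//=.
rewrite /finite_norm -/(L2norm mu f) (L2norm_ae f g)//.
by move: g2; rewrite /L2/= inE => /andP[_]; rewrite inE.
Qed.

Lemma L2norm_scale a f : L2 mu f -> L2norm mu (a *: f) = (`|a|%:E * L2norm mu f)%E.
Proof.
move=> f2; have p1 : (1 <= 2%:E :> \bar R)%E by rewrite lee1n.
exact: (LnormZ (Lfun_Sub p1 f2) a).
Qed.

Lemma L2norm_le_comb a f g h : L2 mu f -> L2 mu g -> measurable_fun setT h ->
  h = a *: f + g %[ae mu] ->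
  (L2norm mu h <= `|a|%:E * L2norm mu f + L2norm mu g)%E.
Proof.
move=> f2 g2 mh hE; rewrite (L2norm_ae h (a *: f + g))//; last first.
  exact/L2_measurable/L2_lin.
rewrite -L2norm_scale//; apply: minkowski_EFin; last by rewrite ler1n.
- exact/L2_measurable/L2_scale.
- exact/L2_measurable.
Qed.

Lemma L2norm_eq0 f : L2 mu f -> L2norm mu f = 0%E -> f = cst 0 %[ae mu].
Proof.
move=> f2 /Lnorm_eq0_eq0 => /(_ _ _)/wrap[].
- exact/measurable_EFinP/L2_measurable.
- by [].
by apply: filterS => x /[apply] -[].
Qed.

Lemma L2_mul_integrable f g : L2 mu f -> L2 mu g ->
  mu.-integrable setT (EFin \o (fun x => f x * g x)).
Proof. by move=> f2 g2; apply/Lfun1_integrable; exact: Lfun2_mul_Lfun1. Qed.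

Lemma Rintegral_ae f g : measurable_fun setT f -> measurable_fun setT g ->
  f = g %[ae mu] -> \int[mu]_x f x = \int[mu]_x g x.
Proof.
move=> mf mg fg; congr fine; apply: ae_eq_integral => //.
- exact/measurable_EFinP.
- exact/measurable_EFinP.
- by apply: filterS fg => x /[apply] ->.
Qed.

Lemma inner_lin a f g h : L2 mu f -> L2 mu g -> L2 mu h ->
  \int[mu]_x ((a *: f + g) x * h x) =
  a * \int[mu]_x (f x * h x) + \int[mu]_x (g x * h x).
Proof.
move=> f2 g2 h2; rewrite -RintegralZl//; last exact: L2_mul_integrable.
under [X in _ = X + _]eq_Rintegral do rewrite mulrA.
rewrite -RintegralD//; last 2 first.
- exact: (L2_mul_integrable (a *: f) h (L2_scale a f f2) h2).
- exact: L2_mul_integrable.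
by apply: eq_Rintegral => x _; rewrite -mulrDl.
Qed.

Lemma inner_sum (I : finType) (c : I -> R) (f : I -> E -> R) h :
  (forall i, L2 mu (f i)) -> L2 mu h ->
  \int[mu]_x ((\sum_i c i *: f i) x * h x) =
  \sum_i c i * \int[mu]_x (f i x * h x).
Proof.
move=> f2 h2.
suff [] : L2 mu (\sum_i c i *: f i) /\
    \int[mu]_x ((\sum_i c i *: f i) x * h x) =
    \sum_i c i * \int[mu]_x (f i x * h x) by [].
elim: (index_enum I) => [|i r [r2 IHr]]; last first.
  by rewrite !big_cons inner_lin// IHr; split=> //; exact: L2_lin.
rewrite !big_nil; split.
  exact: (Lfun_submod_closed mu (lee1n 2 : (1 <= 2%:E)%E)).1.
by under eq_Rintegral do rewrite mul0r; rewrite Rintegral_cst// mul0r.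
Qed.

Lemma inner_orthogonal_sums (I : finType) (b c : I -> R) (f : I -> E -> R) :
  (forall i, L2 mu (f i)) ->
  (forall i j, i != j -> \int[mu]_x (f i x * f j x) = 0) ->
  \int[mu]_x ((\sum_i b i *: f i) x * (\sum_i c i *: f i) x) =
  \sum_i b i * c i * \int[mu]_x (f i x ^+ 2).
Proof.
move=> f2 fo; rewrite inner_sum//; last exact: L2_sum.
apply: eq_bigr => i _; rewrite -mulrA; congr (_ * _).
under eq_Rintegral do rewrite mulrC.
rewrite inner_sum// (bigD1 i)//= big1 ?addr0// => j ji.
by rewrite fo ?mulr0.
Qed.

End L2_space.

(** * The generator of the semigroup *)

Section generator.
Context {d : measure_display} {E : measurableType d} {R : realType}.
Variables (mu : probability E R) (P : R -> (E -> R) -> (E -> R)).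
Implicit Types (f g h u v w : E -> R) (a b : R).

Lemma cvg_lin0 a (x y : R -> \bar R) :
  x t @[t --> 0^'+] --> 0%E -> y t @[t --> 0^'+] --> 0%E ->
  (`|a|%:E * x t + y t)%E @[t --> 0^'+] --> 0%E.
Proof.
move=> x0 y0; rewrite [X in _ --> X](_ : _ = `|a|%:E * 0 + 0)%E; last first.
  by rewrite mule0 adde0.
by apply: cvgeD => //; exact: cvgeZl.
Qed.

Section limit.
Hypothesis hP : symmetric_markov_semigroup mu P.

Lemma L2_quotient f u (t : R) : 0 < t -> L2 mu f -> L2 mu u ->
  L2 mu (t^-1 *: (P t f - f) - u).
Proof.
move=> t0 f2 u2; have Pf2 := sg_L2 hP (ltW t0) f2.
by apply: L2_sub => //; apply: L2_scale; exact: L2_sub.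
Qed.

(** A limit version of the linearity of [P t], in which [h] and [w] are prescribed
    up to null sets only: the difference quotient of [h] is almost everywhere the
    same combination of those of [f] and [g], and Minkowski's inequality
    squeezes the error. *)
Lemma generator_limit_lin a f g h u v w :
  L2 mu f -> L2 mu g -> L2 mu h -> L2 mu u -> L2 mu v -> L2 mu w ->
  h = a *: f + g %[ae mu] -> w = a *: u + v %[ae mu] ->
  generator_limit mu P f u -> generator_limit mu P g v ->
  generator_limit mu P h w.
Proof.
move=> f2 g2 h2 u2 v2 w2 hE wE fu gv.
have bnd := cvg_lin0 a _ _ fu gv.
rewrite /generator_limit; apply: (squeeze_cvge _ (cvg_cst 0%E) bnd).
near=> t; have t0 : 0 < t by near: t; exact: nbhs_right_gt.
have L2q := L2_quotient _ _ t t0.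
rewrite Lnorm_ge0/=; apply: L2norm_le_comb; [exact: L2q|exact: L2q|exact/L2_measurable/L2q|].
have := sg_ae hP (ltW t0) h2 (L2_lin mu a f g f2 g2) hE.
have := sg_linear hP a (ltW t0) f2 g2.
move=> Plin Pae; near=> x => _.
have hx : h x = (a *: f + g) x by near: x; apply: filterS hE => x /(_ I).
have wx : w x = (a *: u + v) x by near: x; apply: filterS wE => x /(_ I).
have Px : P t h x = (a *: P t f + P t g) x.
  by near: x; apply: filterS2 Pae Plin => x /(_ I) -> /(_ I).
rewrite !fctE hx wx Px !fctE /GRing.scale/=; ring.
Unshelve. all: by end_near. Qed.

Lemma generator_limit_unique f u v : L2 mu f -> L2 mu u -> L2 mu v ->
  generator_limit mu P f u -> generator_limit mu P f v -> u = v %[ae mu].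
Proof.
move=> f2 u2 v2 fu fv.
have uv2 : L2 mu (u - v) by exact: L2_sub.
suff /(L2norm_eq0 mu _ uv2) : L2norm mu (u - v) = 0%E.
  by apply: filterS => x /[apply]; rewrite !fctE => /eqP; rewrite subr_eq0 => /eqP.
have bnd := cvg_lin0 (-1) _ _ fu fv.
apply/eqP; rewrite eq_le Lnorm_ge0 andbT.
apply: (cvge_ge _ bnd).
near=> t; have t0 : 0 < t by near: t; exact: nbhs_right_gt.
apply: L2norm_le_comb; [exact: L2_quotient|exact: L2_quotient|exact: (L2_measurable _ _ uv2)|].
by apply: aeW => x _; rewrite !fctE /GRing.scale/=; ring.
Unshelve. all: by end_near. Qed.

End limit.

Variables (L : (E -> R) -> (E -> R)) (A : set (E -> R)).
Hypothesis hL : markov_operator mu P L A.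

Lemma domain_L2 f : generator_domain mu P f -> L2 mu f.
Proof. by case. Qed.

Lemma generator_L2 f : generator_domain mu P f -> L2 mu (L f).
Proof. by case/(mo_generator hL). Qed.

(** The combination of the limits at [f] and [g] is a limit at [h], hence
    is [L h] by uniqueness of limits. Asking for an almost everywhere equality
    only makes this cover linearity of [L] and its independence of the
    representative at once. *)
Lemma generator_lin a f g h : generator_domain mu P f ->
  generator_domain mu P g -> measurable_fun setT h ->
  h = a *: f + g %[ae mu] ->
  generator_domain mu P h /\ L h = a *: L f + L g %[ae mu].
Proof.
move=> fD gD mh hE; have hP := mo_semigroup hL.
have [[f2 _] [g2 _]] := (fD, gD).
have [Lf2 fLf] := mo_generator hL fD; have [Lg2 gLg] := mo_generator hL gD.
have h2 : L2 mu h by apply: L2_ae hE => //; exact: L2_lin.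
have Lfg2 : L2 mu (a *: L f + L g) by exact: L2_lin.
have hl : generator_limit mu P h (a *: L f + L g).
  by apply: (generator_limit_lin hP a f g h (L f) (L g)) => //; exact: aeW.
have hD : generator_domain mu P h by split=> //; exists (a *: L f + L g).
split=> //; have [Lh2 hLh] := mo_generator hL hD.
exact: (generator_limit_unique hP h).
Qed.

Lemma generator_scale a f h : generator_domain mu P f -> measurable_fun setT h ->
  h = a *: f %[ae mu] ->
  generator_domain mu P h /\ L h = a *: L f %[ae mu].
Proof.
move=> fD mh hE; have [|hD LhE] := generator_lin (a - 1) f f h fD fD mh.
  by apply: filterS hE => x /[apply] ->; rewrite !fctE /GRing.scale/=; ring.
by split=> //; apply: filterS LhE => x /[apply] ->; rewrite !fctE /GRing.scale/=; ring.
Qed.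

Lemma generator_sum (I : finType) (c : I -> R) (f : I -> E -> R) :
  (forall i, generator_domain mu P (f i)) ->
  generator_domain mu P (\sum_i c i *: f i) /\
  L (\sum_i c i *: f i) = \sum_i c i *: L (f i) %[ae mu].
Proof.
move=> fD; elim: (index_enum I) => [|i r [rD IHr]]; last first.
  rewrite !big_cons.
  have [||sD sE] :=
    generator_lin (c i) _ _ (c i *: f i + \sum_(j <- r) c j *: f j) (fD i) rD.
  - have := L2_lin mu (c i) _ _ (domain_L2 _ (fD i)) (domain_L2 _ rD).
    exact: L2_measurable.
  - exact: aeW.
  split=> //; move: sE IHr; apply: filterS2 => x + + _ => -> // IHx.
  by rewrite !fctE IHx.
(* 0 lies in the domain as a multiple of the constant 1 *)
have oneD := mo_dom hL (mo_alg1 hL).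
rewrite !big_nil; have [||zD zE] := generator_scale 0 (cst 1) 0 oneD.
- exact: measurable_cst.
- by apply: aeW => x _; rewrite !fctE scale0r.
by split=> //; apply: filterS zE => x /[apply] ->; rewrite !fctE scale0r.
Qed.

(** Symmetry of L: the inner product of [f] and [g] is multiplied by [- a] or by
    [- b] according to the factor on which L acts. *)
Lemma eigenspace_orthogonal a b f g : a != b ->
  eigenspace_of mu P L a f -> eigenspace_of mu P L b g ->
  \int[mu]_x (f x * g x) = 0.
Proof.
move=> ab [fD fE] [gD gE].
have [f2 g2] := (domain_L2 _ fD, domain_L2 _ gD).
have [Lf2 Lg2] := (generator_L2 _ fD, generator_L2 _ gD).
have inner_eigen c u v : L2 mu u -> L2 mu v -> L2 mu (L v) ->
    - L v = c *: v %[ae mu] ->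
    \int[mu]_x (u x * L v x) = - c * \int[mu]_x (u x * v x).
  move=> u2 v2 Lv2 vE; rewrite -RintegralZl//; last exact: L2_mul_integrable.
  have [mf mv] := (L2_measurable _ _ u2, L2_measurable _ _ v2).
  have mLv := L2_measurable _ _ Lv2.
  apply: Rintegral_ae.
  - exact: measurable_funM.
  - by apply: measurable_funM => //; exact: measurable_funM.
  apply: filterS vE => x /[apply]; rewrite !fctE => /eqP.
  by rewrite eqr_oppLR => /eqP ->; rewrite /GRing.scale/=; ring.
have := mo_reversible hL fD gD.
rewrite (inner_eigen b)// (inner_eigen a)//.
under [in RHS]eq_Rintegral do rewrite mulrC.
move=> /eqP; rewrite -subr_eq0 -mulrBl mulf_eq0 opprK addrC subr_eq0.
by rewrite (negbTE ab) => /eqP.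
Qed.

End generator.

(** * Lagrange interpolation at the first eigenvalues *)

Section polynomials.
Context {R : realType}.
Variable lambda : nat -> R.
Hypothesis lambda_mono : {homo lambda : m n / (m < n)%N >-> m < n}.

Lemma lambda_inj : injective lambda.
Proof.
move=> m n mn; apply/eqP; case: ltngtP => // /lambda_mono; by rewrite mn ltxx.
Qed.

Lemma Qcoef_coef k i : Qcoef lambda k i = (Qpoly lambda k)`_i.
Proof.
rewrite /Qcoef horner_coef0 coef_derivn addn0 ffactnn -[X in _ * X]mulr_natl mulrA.
by rewrite mulVf ?mul1r// pnatr_eq0 -lt0n fact_gt0.
Qed.

Lemma Qpoly_coef0 k : (0 < k)%N -> lambda 0 = 0 -> (Qpoly lambda k)`_0 = 0.
Proof.
case: k => // k _ l0; rewrite -horner_coef0 /Qpoly big_ord_recl hornerM.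
by rewrite hornerXsubC l0 subr0 mul0r.
Qed.

Definition lagrange_basis k (i : 'I_k.+1) : {poly R} :=
  tnth (k.+1.-lagrange lambda) i.

(** [(X - lambda_i) l_i] vanishes at all nodes, and so is a multiple of
    [Q_(k+1)]; this is what turns [l_i(M)(F^2)] into an eigenfunction. *)
Lemma mulX_lagrange k (i : 'I_k.+1) : exists c,
  'X * lagrange_basis k i =
  lambda i *: lagrange_basis k i + c *: Qpoly lambda k.+1.
Proof.
rewrite /lagrange_basis lagrangeE//; last exact: lambda_inj.
cbv beta zeta.
set c := (_^-1); set p := \prod_(_ < _ | _) _; exists c.
rewrite /Qpoly (bigD1 i)//= -/p -!mul_polyC; ring.
Qed.

Lemma lagrangeXn k m : (m <= k)%N ->
  'X^m = \sum_(i < k.+1) lambda i ^+ m *: lagrange_basis k i.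
Proof.
move=> mk.
rewrite [LHS](@lagrange_gen _ k.+1 lambda _ lambda_inj)//; last by rewrite size_polyXn.
by apply: eq_bigr => i _; rewrite hornerXn mul_polyC.
Qed.

Lemma sum_coefXM n (p : {poly R}) (g : nat -> R) :
  \sum_(j < n.+1) ('X * p)`_j * g j = \sum_(j < n) p`_j * g j.+1.
Proof.
rewrite big_ord_recl coefXM mul0r add0r.
by apply: eq_bigr => j _; rewrite coefXM.
Qed.

(** For a sequence [g] with [g (j + 1) = M (g j)] this is the eigenvector
    equation [M u = lambda_i u] for [u = l_i(M)(g 0)], the hypothesis being
    [Q_(k+1)(M)(g 0) = 0]. *)
Lemma lagrange_shift k (i : 'I_k.+1) (g : nat -> R) :
  \sum_(j < k.+2) (Qpoly lambda k.+1)`_j * g j = 0 ->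
  \sum_(j < k.+1) (lagrange_basis k i)`_j * g j.+1 =
  lambda i * \sum_(j < k.+1) (lagrange_basis k i)`_j * g j.
Proof.
move=> Qg0; have [c Xl] := mulX_lagrange k i.
rewrite -sum_coefXM Xl.
under eq_bigr do rewrite coefD !coefZ mulrDl -!mulrA.
rewrite big_split/= -!mulr_sumr Qg0 mulr0 addr0 big_ord_recr/=.
rewrite (nth_default _ (_ : (size (lagrange_basis k i) <= k.+1)%N)) ?mul0r ?addr0//.
by rewrite /lagrange_basis size_lagrange_//; exact: lambda_inj.
Qed.

End polynomials.

(** * Iterated gradients of a chaos eigenfunction *)

Section chaos.
Context {d : measure_display} {E : measurableType d} {R : realType}.
Variables (mu : probability E R) (P : R -> (E -> R) -> (E -> R)).
Variables (L : (E -> R) -> (E -> R)) (A : set (E -> R)) (lambda : nat -> R).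
Hypothesis hL : markov_operator mu P L A.
Implicit Types (f g : E -> R) (a b : R).

Lemma Gamma_iterS m f g : Gamma_iter L m.+1 f g =
  2^-1 *: (L (Gamma_iter L m f g) - Gamma_iter L m f (L g) - Gamma_iter L m g (L f)).
Proof. by case: m. Qed.

(** The recursion for [Gamma_iter L m.+1 F F] involves [L F], which is a multiple
    of F only almost everywhere, and in turn [L (L F)], and so on. Bilinearity
    is therefore needed for arbitrary representatives [f], [g] of multiples of F,
    together with their square-integrability, which an almost everywhere equality
    alone does not transfer for lack of measurability. *)
Lemma Gamma_iter_homogeneous c F k : eigenspace_of mu P L c F ->
  (forall m, (m <= k)%N -> generator_domain mu P (Gamma_iter L m F F)) ->
  forall m, (m <= k)%N -> forall a b f g, L2 mu f -> L2 mu g ->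
  f = a *: F %[ae mu] -> g = b *: F %[ae mu] ->
  L2 mu (Gamma_iter L m f g) /\
  Gamma_iter L m f g = (a * b) *: Gamma_iter L m F F %[ae mu].
Proof.
move=> [FD FE] GD.
have step a f : L2 mu f -> f = a *: F %[ae mu] ->
    L2 mu (L f) /\ L f = (a * - c) *: F %[ae mu].
  move=> f2 fE.
  have [fD LfE] := generator_scale mu P L A hL a F f FD (L2_measurable mu f f2) fE.
  split; first exact: (generator_L2 _ _ _ _ hL).
  move: LfE FE; apply: filterS2 => x /(_ I) -> /(_ I) + _.
  rewrite !fctE => /eqP; rewrite eqr_oppLR => /eqP ->; rewrite /GRing.scale/=; ring.
elim=> [|m IHm] mk a b f g f2 g2 fE gE.
  have FF2 : L2 mu (F * F) := domain_L2 mu P _ (GD 0 mk).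
  have fgE : f * g = (a * b) *: (F * F) %[ae mu].
    move: fE gE; apply: filterS2 => x /(_ I) fx /(_ I) gx _.
    by rewrite !fctE fx gx !fctE /GRing.scale/=; ring.
  split=> //=; apply: (L2_ae mu _ _ _ (L2_scale mu (a * b) _ FF2) fgE).
  by apply: measurable_funM; exact: (L2_measurable mu).
have {}IHm := IHm (ltnW mk).
have F2 := domain_L2 mu P _ FD.
have FF : F = 1 *: F %[ae mu] by apply: aeW => x _; rewrite scale1r.
have [Lf2 LfE] := step _ _ f2 fE; have [Lg2 LgE] := step _ _ g2 gE.
have [LF2 LFE] := step _ _ F2 FF.
have [G2 GE] := IHm _ _ _ _ f2 g2 fE gE.
have [GfL2 GfLE] := IHm _ _ _ _ f2 Lg2 fE LgE.
have [GgL2 GgLE] := IHm _ _ _ _ g2 Lf2 gE LfE.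
have [GFL2 GFLE] := IHm _ _ _ _ F2 LF2 FF LFE.
have [GfgD LGE] := generator_scale mu P L A hL _ _ _ (GD m (ltnW mk))
  (L2_measurable mu _ G2) GE.
rewrite !Gamma_iterS; split.
  apply: L2_scale; do 2 apply: L2_sub => //.
  exact: (generator_L2 _ _ _ _ hL).
near=> x => _.
have e1 : Gamma_iter L m f (L g) x = ((a * (b * - c)) *: Gamma_iter L m F F) x.
  by near: x; apply: filterS GfLE => x /(_ I).
have e2 : Gamma_iter L m g (L f) x = ((b * (a * - c)) *: Gamma_iter L m F F) x.
  by near: x; apply: filterS GgLE => x /(_ I).
have e3 : Gamma_iter L m F (L F) x = ((1 * (1 * - c)) *: Gamma_iter L m F F) x.
  by near: x; apply: filterS GFLE => x /(_ I).
have e4 : L (Gamma_iter L m f g) x = ((a * b) *: L (Gamma_iter L m F F)) x.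
  by near: x; apply: filterS LGE => x /(_ I).
rewrite !fctE e1 e2 e3 e4 !fctE /GRing.scale/=; ring.
Unshelve. all: by end_near. Qed.

(** On an eigenfunction the two terms containing [L F] merge with the factor 1/2
    into [c]: iterating Gamma amounts to applying the operator L/2 + c. *)
Lemma Gamma_iter_rec c F k : eigenspace_of mu P L c F ->
  (forall m, (m <= k)%N -> generator_domain mu P (Gamma_iter L m F F)) ->
  forall m, (m <= k)%N -> Gamma_iter L m.+1 F F =
    2^-1 *: L (Gamma_iter L m F F) + c *: Gamma_iter L m F F %[ae mu].
Proof.
move=> eF GD m mk; have [FD FE] := eF; have F2 := domain_L2 mu P _ FD.
have LF2 := generator_L2 mu P L A hL F FD.
have FF : F = 1 *: F %[ae mu] by apply: aeW => x _; rewrite scale1r.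
have LFE : L F = (- c) *: F %[ae mu].
  apply: filterS FE => x /[apply]; rewrite !fctE => /eqP.
  by rewrite eqr_oppLR => /eqP ->; rewrite scaleNr.
have [_] := Gamma_iter_homogeneous c F k eF GD m mk 1 (- c) F (L F) F2 LF2 FF LFE.
rewrite Gamma_iterS; apply: filterS => x /[apply] e.
rewrite !fctE e !fctE /GRing.scale/=; lra.
Qed.

Section decomposition.
Hypothesis lambda_mono : {homo lambda : m n / (m < n)%N >-> m < n}.

(** The eigenvector equation [(L/2 + lambda_k) u_i = lambda_i u_i] is recorded
    as membership in the eigenspace of -L for [2 (lambda_k - lambda_i)]. Each
    [G m], with [m <= k], is the combination given by interpolating [X^m]
    at the nodes, which is exact since its degree is at most k. *)
Lemma chaos_decomposition k (G : nat -> E -> R) :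
  (forall j, (j <= k)%N -> generator_domain mu P (G j)) ->
  (forall j, (j <= k)%N ->
    G j.+1 = 2^-1 *: L (G j) + lambda k *: G j %[ae mu]) ->
  \sum_(j < k.+2) (Qpoly lambda k.+1)`_j *: G j = cst 0 %[ae mu] ->
  exists u : 'I_k.+1 -> E -> R,
    (forall i : 'I_k.+1, eigenspace_of mu P L (2 * (lambda k - lambda i)) (u i)) /\
    (forall m, (m <= k)%N -> G m = \sum_(i < k.+1) lambda i ^+ m *: u i).
Proof.
move=> GD GS QG.
exists (fun i => \sum_(j < k.+1) (lagrange_basis lambda k i)`_j *: G j); split=> [i|m mk].
  have [|uD uE] := generator_sum mu P L A hL _
    (fun j : 'I_k.+1 => (lagrange_basis lambda k i)`_j) (fun j : 'I_k.+1 => G j).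
    by move=> j; apply: GD; rewrite -ltnS.
  split=> //.
  have {}GS : \forall x \ae mu, forall j : 'I_k.+1,
      G j.+1 x = 2^-1 * L (G j) x + lambda k * G j x.
    apply: filter_forall => j; apply: filterS (GS j _) => [x /(_ I)//|].
    by rewrite -ltnS.
  move: uE GS QG; apply: filterS3 => x /(_ I) uE GS /(_ I) QG _.
  rewrite fct_sumE in QG.
  have := lagrange_shift lambda lambda_mono k i (fun j => G j x) QG.
  rewrite (eq_bigr (fun j : 'I_k.+1 => 2^-1 * ((lagrange_basis lambda k i)`_j * L (G j) x)
     + lambda k * ((lagrange_basis lambda k i)`_j * G j x))); last first.
    by move=> j _; rewrite GS; ring.
  rewrite big_split/= -!mulr_sumr => e.
  rewrite opprfctE scalrfctE /= uE !fct_sumE /GRing.scale/=.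
  lra.
apply/funext => x; rewrite fct_sumE.
under eq_bigr do rewrite !fctE fct_sumE scaler_sumr.
rewrite exchange_big/=.
transitivity (\sum_(j < k.+1) ('X^m : {poly R})`_j * G j x).
  rewrite (bigD1 (Ordinal (mk : (m < k.+1)%N)))//= coefXn eqxx mul1r big1 ?addr0//.
  by move=> j /negPf jm; rewrite coefXn; rewrite -val_eqE/= in jm; rewrite jm mul0r.
apply: eq_bigr => j _; rewrite (lagrangeXn lambda lambda_mono k m mk) coef_sum mulr_suml.
by apply: eq_bigr => i _; rewrite coefZ -mulrA.
Qed.

End decomposition.
End chaos.

(** * The inequality and the variance bound *)

(** Q_(k+1)(0) = 0, so the sum may as well start with Gamma_0(f, g) = f g; this
    is what makes F^2, rather than Gamma(F), the vector to decompose. *)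
Lemma QGamma_sum {d : measure_display} {E : measurableType d} {R : realType}
    (L : (E -> R) -> (E -> R)) (lambda : nat -> R) (k : nat) (f g : E -> R) :
  lambda 0 = 0 ->
  QGamma L lambda k.+1 f g =
  \sum_(j < k.+2) (Qpoly lambda k.+1)`_j *: Gamma_iter L j f g.
Proof.
move=> l0; rewrite /QGamma -(big_mkord xpredT
  (fun j => (Qpoly lambda k.+1)`_j *: Gamma_iter L j f g)) [RHS]big_ltn//.
rewrite Qpoly_coef0// scale0r add0r.
by apply: eq_bigr => j _; rewrite Qcoef_coef.
Qed.

Theorem corollary7 (d : measure_display) (E : measurableType d) (R : realType)
    (mu : probability E R) (P : R -> (E -> R) -> (E -> R))
    (L : (E -> R) -> (E -> R)) (A : set (E -> R)) (lambda : nat -> R)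
    (hL : markov_operator mu P L A)
    (hS : pure_point_spectrum mu P L lambda)
    (k : nat) (hk : (1 <= k)%N)
    (F : E -> R) (hF : chaos_eigenfunction mu P L lambda k F)
    (hT : forall n : nat,
        (-1) ^+ k * (Tpoly lambda k.+1).[- (lambda n / 2)] <= 0) :
  \int[mu]_x (Gamma L F F x ^+ 2)
    <= lambda k * \int[mu]_x (F x ^+ 2 * Gamma L F F x)
  /\ (\int[mu]_x (F x ^+ 2) = 1 ->
      \int[mu]_x (Gamma L F F x) = lambda k
      /\ ('V_mu[Gamma L F F]
          <= (lambda k * (\int[mu]_x (F x ^+ 2 * Gamma L F F x)
                          - lambda k))%:E)%E).
Proof.
have lambda_mono := pps_increasing hS; have lambda0 := pps_0 hS.
have [eF GD QG] := hF; have [FD _] := eF.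
have GS := Gamma_iter_rec mu P L A hL _ F k eF GD.
have [|u [uE Gu]] := chaos_decomposition mu P L A lambda hL lambda_mono k
    (fun j => Gamma_iter L j F F) GD GS.
  by rewrite -QGamma_sum.
have u2 i : L2 mu (u i) by have [/(domain_L2 mu P)] := uE i.
have uo (i j : 'I_k.+1) : i != j -> \int[mu]_x (u i x * u j x) = 0.
  move=> ij; apply: (eigenspace_orthogonal mu P L A hL) (uE i) (uE j).
  rewrite (inj_eq (mulfI _)) ?pnatr_eq0// (inj_eq (addrI _)) eqr_opp.
  by rewrite (inj_eq (lambda_inj _ lambda_mono)).
have FF : F * F = \sum_(i < k.+1) lambda i ^+ 0 *: u i := Gu 0 isT.
have GF : Gamma L F F = \sum_(i < k.+1) lambda i ^+ 1 *: u i := Gu 1 hk.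
have F2 : L2 mu (F * F) := domain_L2 mu P _ (GD 0 isT).
have G2 : L2 mu (Gamma L F F) := domain_L2 mu P _ (GD 1 hk).
have Gamma_sqr : \int[mu]_x (Gamma L F F x ^+ 2) =
    \sum_(i < k.+1) lambda i ^+ 2 * \int[mu]_x (u i x ^+ 2).
  under eq_Rintegral do rewrite expr2 GF.
  by rewrite inner_orthogonal_sums//; apply: eq_bigr => i _; rewrite -exprD.
have F_Gamma : \int[mu]_x (F x ^+ 2 * Gamma L F F x) =
    \sum_(i < k.+1) lambda i * \int[mu]_x (u i x ^+ 2).
  have -> : \int[mu]_x (F x ^+ 2 * Gamma L F F x) =
      \int[mu]_x ((F * F) x * Gamma L F F x).
    by apply: eq_Rintegral => x _; rewrite !fctE.
  rewrite FF GF inner_orthogonal_sums//.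
  by apply: eq_bigr => i _; rewrite expr0 mul1r expr1.
have main : \int[mu]_x (Gamma L F F x ^+ 2)
    <= lambda k * \int[mu]_x (F x ^+ 2 * Gamma L F F x).
  rewrite Gamma_sqr F_Gamma mulr_sumr; apply: ler_sum => i _.
  have li0 : 0 <= lambda i.
    by rewrite -lambda0; case: (nat_of_ord i) => [//|n]; exact/ltW/lambda_mono.
  have lik : lambda i <= lambda k.
    have : (i <= k)%N by rewrite -ltnS.
    by rewrite leq_eqVlt => /predU1P[->//|/lambda_mono/ltW].
  rewrite mulrA expr2; apply: ler_wpM2r; last exact: ler_wpM2r.
  by apply: Rintegral_ge0 => x _; exact: sqr_ge0.
split=> // F1.
have int1 f : L2 mu f -> mu.-integrable setT (EFin \o f).
  move=> f2; apply/Lfun1_integrable; apply: Lfun_subset12 => //.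
  exact: fin_num_measure.
have mean : \int[mu]_x Gamma L F F x = lambda k.
  have LF2 := generator_L2 mu P L A hL _ (GD 0 isT).
  have -> : \int[mu]_x Gamma L F F x =
      \int[mu]_x (2^-1 * L (F * F) x + lambda k * (F * F) x).
    apply: Rintegral_ae.
    - exact: (L2_measurable mu).
    - exact: (L2_measurable mu _ (L2_lin mu 2^-1 _ _ LF2 (L2_scale mu (lambda k) _ F2))).
    - by apply: filterS (GS 0 isT) => x /[apply].
  rewrite RintegralD//; last 2 first.
  - exact: (int1 _ (L2_scale mu 2^-1 _ LF2)).
  - exact: (int1 _ (L2_scale mu (lambda k) _ F2)).
  rewrite !RintegralZl//; [|exact: int1|exact: int1].
  rewrite (mo_invariant hL (GD 0 isT)) mulr0 add0r.
  have -> : \int[mu]_x (F * F) x = 1.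
    by rewrite -F1; apply: eq_Rintegral => x _; rewrite !fctE.
  by rewrite mulr1.
split=> //; rewrite varianceE//.
have E_int f : mu.-integrable setT (EFin \o f) ->
    ('E_mu[f] = (\int[mu]_x f x)%:E)%E.
  move=> fi; rewrite unlock /Rintegral fineK//.
  exact: integrable_fin_num.
rewrite !E_int; [|exact: int1|exact: Lfun2_integrable_sqr].
rewrite mean -EFin_expe -EFinB lee_fin.
rewrite mulrBr lerB ?expr2//.
Qed.
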